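(* Let $g\ge1$ be an integer, let $p$ be a prime with $\gcd(p,2(2g+1))=1$, let $M$ be an integer with $1\le M<p$ and let $\mathfrak B=[R_0+1,R_0+M]\times\dots\times[R_{2g-1}+1,R_{2g-1}+M]$ with integers $R_j$ satisfying $0\le R_j<R_j+M<p$ for $j=0,\dots,2g-1$. Let $\mathcal H(\mathfrak B)$ be a set of representatives of all isomorphism classes of the curves $H_{\mathbf a}$, $\mathbf a\in\mathfrak B\cap\mathbb{Z}^{2g}$. Then $$\#\mathcal H(\mathfrak B)\gg\min\{p^{2g-1},M^{2g+o(1)}\}$$ as $M\to\infty$. Furthermore, if $g\ge2$ and $M>p^{1/(2g)}$, then $\#\mathcal H(\mathfrak B)\gg\min\{p^{2g-1},M^{2g}\}$.
   Context: For $\mathbf a=(a_0,\dots,a_{2g-1})\in\mathbb{F}_p^{2g}$, $H_{\mathbf a}$ denotes the curve $Y^2=X^{2g+1}+a_{2g-1}X^{2g-1}+\dots+a_1X+a_0$ over $\mathbb{F}_p$; integer vectors in $\mathfrak B$ are reduced modulo $p$. Isomorphism of such curves: $H_{\mathbf a}\sim H_{\mathbf b}$ if and only if there exists $\alpha\in\mathbb{F}_p^*$ with $a_i\equiv\alpha^{4g+2-2i}b_i\pmod p$ for $i=0,\dots,2g-1$. Implied constants depend only on $g$; $M^{o(1)}$ denotes $M^{\varepsilon(M)}$ with $\varepsilon(M)\to0$ as $M\to\infty$, uniformly in $p$ and $\mathfrak B$. *)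

(* Defs.v *)
From HB Require Import structures.
From mathcomp Require Import all_boot all_order all_algebra finmap.
From mathcomp Require Import all_classical all_reals all_analysis.

Set Implicit Arguments.
Unset Strict Implicit.
Unset Printing Implicit Defensive.

Import Order.TTheory GRing.Theory Num.Theory.
Import numFieldNormedType.Exports.

Local Open Scope classical_set_scope.
Local Open Scope ring_scope.

(* The curve Y^2 = X^(2g+1) + a_(2g-1) X^(2g-1) + ... + a_0, encoded by its
   defining polynomial in F[X][Y]: the outer indeterminate is Y, the inner one
   is X.  No smoothness condition is imposed on a. *)
Definition hcurve (F : fieldType) (g : nat) (a : 'rV[F]_(2 * g)) :
    {poly {poly F}} :=
  'X^2 - ('X^(2 * g + 1) + \sum_(i < 2 * g) a 0 i *: 'X^i)%:P.

(* The natural subtraction never truncates, since i < 2g. *)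
Definition hisom (F : fieldType) (g : nat) (C D : {poly {poly F}}) : Prop :=
  exists (a b : 'rV[F]_(2 * g)) (alpha : F),
    [/\ C = hcurve a, D = hcurve b, alpha != 0
      & forall i, a 0 i = alpha ^+ (4 * g + 2 - 2 * i) * b 0 i].

Definition int_box (n : nat) (r : 'I_n -> int) (M : nat) : set 'rV[int]_n :=
  [set a : 'rV[int]_n | forall j, r j + 1 <= a 0 j <= r j + M%:Z].

Definition box_curves (p g : nat) (r : 'I_(2 * g) -> int) (M : nat) :
    set {poly {poly 'F_p}} :=
  [set hcurve (map_mx (fun z : int => z%:~R : 'F_p) a) | a in int_box r M].
Arguments box_curves p {g} r M _.

Definition is_representatives (F : fieldType) (g : nat)
    (S : set {poly {poly F}}) (H : {fset {poly {poly F}}}) : Prop :=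
  (forall C, C \in H -> S C) /\
  (forall C, S C -> exists! D, D \in H /\ hisom g C D).

(* Main.v *)
Require Import Defs.
From mathcomp Require Import all_boot all_order all_algebra finmap.
From mathcomp Require Import all_classical all_reals all_analysis.
From mathcomp Require Import zify ring lra.

Import Order.TTheory GRing.Theory Num.Theory.
Import numFieldNormedType.Exports.

Local Open Scope classical_set_scope.
Local Open Scope ring_scope.

(** By Cauchy-Schwarz, the square of the number [M ^ (2g)] of points of the box
    is at most the number of classes times the number of isomorphic pairs, and
    the latter is at most the sum over [alpha] of the product over [i] of
    [N_i (alpha ^ (4g + 2 - 2i))], where [N_i lam] counts the points of slope
    [lam] in the square of the [i]-th side.  A product of [2g] naturals is at
    most the sum of their [2g]-th powers, so everything reduces to bounding
    [\sum_lam (N_i lam) ^ (2g)].  When [N_i lam > 1], let [m] be the least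
    sup-norm of a difference of two solutions: the solutions lie on
    [O(m M / p + 1)] lines, with [O(M / m)] of them on each, so that
    [N_i lam <= 8 M ^ 2 / p + 2 M / m].  A difference of norm [m] determines
    [lam], so that the terms [(2 M / m) ^ (2g)] sum to [O(M ^ (2g))] for
    [g >= 2] and to [O(M ^ 2 (1 + ln M) ^ 2)] for [g = 1]. *)

(** * Collisions of a map between finite types *)

(** The fibre sizes [n d] sum to [#|T|], and their squares count the colliding pairs. *)
Lemma card_collisions (T U : finType) (f : T -> U) :
  (#|T| ^ 2 <= #|U| * #|[pred z : T * T | f z.1 == f z.2]|)%N.
Proof.
pose n d := #|[pred x | f x == d]|.
have cardT : #|T| = (\sum_d n d)%N.
  rewrite -sum1_card (partition_big f xpredT) //=.
  by apply: eq_bigr => d _; rewrite /n -sum1_card.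
have -> : #|[pred z : T * T | f z.1 == f z.2]| = (\sum_d n d ^ 2)%N.
  rewrite -sum1_card (partition_big (fun z => f z.1) xpredT) //=.
  apply: eq_bigr => d _; rewrite -mulnn /n -sum1_card big_distrlr /= pair_big /=.
  apply: eq_bigl => -[x y]; rewrite !inE /=.
  by case: (f x =P d) => [->|]; rewrite ?andbF ?andbT // eq_sym.
(* Doubling allows a termwise comparison over all pairs [(d, e)]: [2 n_d n_e <= n_d^2 + n_e^2]. *)
rewrite cardT -mulnn big_distrlr /= -(leq_pmul2l (isT : 0 < 2)%N).
rewrite [leqRHS](_ : _ = (\sum_d \sum_e (n d ^ 2 + n e ^ 2)))%N; last first.
  under [RHS]eq_bigr do rewrite big_split /=.
  rewrite big_split /= sum_nat_const; under [X in _ = (X + _)%N]eq_bigr do rewrite sum_nat_const.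
  by rewrite -big_distrr /= mul2n addnn.
rewrite big_distrr; apply: leq_sum => d _; rewrite big_distrr; apply: leq_sum => e _.
exact: nat_Cauchy.
Qed.

(** * Points of a given slope in the square of one side *)

(* The box side is [c + 0, ..., c + (M - 1)]. *)
Definition ratio_hits {p M : nat} (c lam : 'F_p) : pred ('I_M * 'I_M) :=
  [pred z : 'I_M * 'I_M | c + z.2%:R == lam * (c + z.1%:R)].

Lemma distn_ord (M : nat) (x y : 'I_M) : (`|x%:Z - y%:Z| < M)%N.
Proof. by have := ltn_ord x; have := ltn_ord y; lia. Qed.

(** Here [u.+1] and [v.+1] are the absolute values of the coordinates of a shortest difference [w]
    of two solutions, whence the undetermined sign. The two factors of the bound count lines of
    direction [w] and cells of length [m] on each line. *)
Lemma card_ratio_hits (p M : nat) (c lam : 'F_p) :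
  prime p -> (M < p)%N -> lam != 0 -> (1 < #|@ratio_hits p M c lam|)%N ->
  exists u v : 'I_M,
    [/\ (v.+1%:R == lam * u.+1%:R) || (v.+1%:R == - (lam * u.+1%:R)) &
        (#|@ratio_hits p M c lam| <=
          (4 * maxn u.+1 v.+1 * M %/ p).+1 * (M %/ maxn u.+1 v.+1).+1)%N].
Proof.
move=> p_pr ltMp lam0 /card_gt1P [z1 [z2 [hz1 hz2 nz12]]].
have pF := pchar_Fp p_pr.
pose good (w : ('I_M * 'I_M) * ('I_M * 'I_M)) :=
  [&& w.1 \in ratio_hits c lam, w.2 \in ratio_hits c lam & w.1 != w.2].
pose du (w : ('I_M * 'I_M) * ('I_M * 'I_M)) : int := w.1.1%:Z - w.2.1%:Z.
pose dv (w : ('I_M * 'I_M) * ('I_M * 'I_M)) : int := w.1.2%:Z - w.2.2%:Z.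
pose size w := maxn `|du w|%N `|dv w|%N.
have good0 : good (z1, z2) by apply/and3P; split.
have [w /and3P[hw1 hw2 nw] minw] := @arg_minnP _ (z1, z2) good size good0.
(* Differences of solutions satisfy the homogeneous equation, whatever [c] is. *)
have slope (z z' : 'I_M * 'I_M) : z \in ratio_hits c lam -> z' \in ratio_hits c lam ->
    (z.2%:Z - z'.2%:Z)%:~R = lam * (z.1%:Z - z'.1%:Z)%:~R.
  rewrite !inE => /eqP e /eqP e'; rewrite !rmorphB /= -!pmulrn.
  have -> : (z.2%:R : 'F_p) - z'.2%:R = (c + z.2%:R) - (c + z'.2%:R) by ring.
  by rewrite e e'; ring.
have small (x y : 'I_M) : (x%:Z - y%:Z)%:~R = 0 :> 'F_p -> x = y.
  move=> /eqP; rewrite -(dvdz_pcharf pF) dvdzE /= => dvd; apply: val_inj => /=.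
  apply/eqP; rewrite -eqz_nat -subr_eq0 -absz_eq0; apply: contraTT dvd.
  by rewrite -lt0n => pos; rewrite gtnNdvd // (ltn_trans (distn_ord _ _ _)).
(* Since [lam] is invertible and [M < p], distinct solutions differ in both coordinates. *)
have eqP_hits (z z' : 'I_M * 'I_M) : z \in ratio_hits c lam -> z' \in ratio_hits c lam ->
    (z.1 == z'.1) = (z.2 == z'.2).
  move=> hz hz'; have e := slope _ _ hz hz'.
  case: (z.1 =P z'.1) => e1; case: (z.2 =P z'.2) => e2 //.
    by case: e2; apply: small; rewrite e e1 subrr mulr0.
  case: e1; apply: small; apply/eqP; move/eqP: e.
  by rewrite e2 subrr eq_sym mulf_eq0 (negPf lam0).
have nw1 : w.1.1 != w.2.1.
  apply: contra nw => e; move: (e); rewrite (eqP_hits _ _ hw1 hw2) => /eqP e2.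
  by move/eqP: e => e1; rewrite (surjective_pairing w.1) (surjective_pairing w.2) e1 e2.
have nw2 : w.1.2 != w.2.2 by rewrite -(eqP_hits _ _ hw1 hw2).
have [du0 dv0] : (0 < `|du w|)%N /\ (0 < `|dv w|)%N.
  by rewrite !absz_gt0 !subr_eq0 !eqz_nat.
have [duM dvM] : (`|du w| <= M)%N /\ (`|dv w| <= M)%N.
  by split; apply: ltnW; apply: distn_ord.
have ltu : (`|du w|.-1 < M)%N by rewrite prednK.
have ltv : (`|dv w|.-1 < M)%N by rewrite prednK.
exists (Ordinal ltu), (Ordinal ltv); rewrite /= !prednK //; split.
  have absF (a : int) : `|a|%N%:R = a%:~R :> 'F_p \/ `|a|%N%:R = - a%:~R :> 'F_p.
    by case: a => k; [left | right; rewrite NegzE rmorphN opprK].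
  have := slope _ _ hw1 hw2; rewrite -/(du w) -/(dv w).
  by case: (absF (du w)) => ->; case: (absF (dv w)) => -> ->;
    rewrite ?mulrN ?opprK eqxx ?orbT.
set m := size w in minw *.
have -> : maxn `|du w| `|dv w| = m by [].
have um : (`|du w| <= m)%N by exact: leq_maxl.
have vm : (`|dv w| <= m)%N by exact: leq_maxr.
have m0 : (0 < m)%N by exact: leq_trans um.
(* [D] is constant modulo [p] on the solutions, and its level sets are lines of
   direction [w]; the shift by [2 m M] makes it nonnegative. *)
pose D (z : 'I_M * 'I_M) : int := du w * z.2%:Z - dv w * z.1%:Z.
pose E z : nat := absz (D z + (2 * m * M)%N%:Z).
have Erange z : (E z)%:Z = D z + (2 * m * M)%N%:Z /\ (E z <= 4 * m * M)%N.
  have h1 : (absz (du w * z.2%:Z)%R <= m * M)%N by rewrite abszM leq_mul // ltnW /=.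
  have h2 : (absz (dv w * z.1%:Z)%R <= m * M)%N by rewrite abszM leq_mul // ltnW /=.
  rewrite /E /D -!mulnA; move: h1 h2; move: (du w * _) (dv w * _) (m * M)%N.
  by clear; split; lia.
have Emod z z' : z \in ratio_hits c lam -> z' \in ratio_hits c lam ->
    E z = E z' %[mod p].
  move=> hz hz'; suff: (p%:Z %| D z - D z')%Z.
    have [e _] := Erange z; have [e' _] := Erange z'.
    have -> : D z - D z' = (E z)%:Z - (E z')%:Z.
      by rewrite e e'; move: (D z) (D z') (2 * m * M)%N%:Z => *; ring.
    by move=> h; apply/eqP; move: h; rewrite -eqz_mod_dvd !modz_nat eqz_nat.
  rewrite (dvdz_pcharf pF) /D.
  have -> : du w * z.2%:Z - dv w * z.1%:Z - (du w * z'.2%:Z - dv w * z'.1%:Z)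
     = du w * (z.2%:Z - z'.2%:Z) - dv w * (z.1%:Z - z'.1%:Z) by ring.
  rewrite rmorphB !rmorphM /= (slope z z' hz hz') (slope _ _ hw1 hw2).
  by apply/eqP; rewrite -/(du w); ring.
(* [pos] is a coordinate in which [w] attains its norm [m]; [key] records the line of a solution and
   its cell of length [m] on that line. *)
pose pos (z : 'I_M * 'I_M) : nat := if (`|du w|%N == m) then z.1 else z.2.
pose key z : 'I_(4 * m * M %/ p).+1 * 'I_(M %/ m).+1 :=
  (inord (E z %/ p), inord (pos z %/ m)).
have key_inj : {in ratio_hits c lam &, injective key}.
  move=> z z' hz hz' [] /(congr1 val) /= + /(congr1 val) /=.
  have [_ r1] := Erange z; have [_ r2] := Erange z'.
  have b1 : (pos z <= M)%N by rewrite /pos; case: ifP => _; exact: ltnW.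
  have b2 : (pos z' <= M)%N by rewrite /pos; case: ifP => _; exact: ltnW.
  rewrite !inordK ?ltnS ?leq_div2r // => eE epos.
  have {}eE : E z = E z'.
    by rewrite (divn_eq (E z) p) (divn_eq (E z') p) eE (Emod _ _ hz hz').
  have eD : du w * (z.2%:Z - z'.2%:Z) = dv w * (z.1%:Z - z'.1%:Z).
    have [e _] := Erange z; have [e' _] := Erange z'.
    move: eE => /(congr1 Posz); rewrite e e' => /addIr /eqP; rewrite /D.
    rewrite !mulrBr; move: (du w * _) (du w * _) (dv w * _) (dv w * _).
    by clear; lia.
  have ab : (`|z.1%:Z - z'.1%:Z| * `|dv w| = `|z.2%:Z - z'.2%:Z| * `|du w|)%N.
    by rewrite -!abszM; congr absz; rewrite mulrC -eD mulrC.
  (* A difference of two solutions with the same key is parallel to [w], hence largest in the same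
     coordinate as [w], where it is less than [m]: this contradicts minimality. *)
  apply/eqP; apply: contraT => nz.
  have := minw (z, z'); rewrite /good /= hz hz' nz => /(_ isT).
  rewrite {1}/size /du /dv /= -/(du w) -/(dv w).
  have close : (`|(pos z)%:Z - (pos z')%:Z| < m)%N.
    have := divn_eq (pos z) m; have := divn_eq (pos z') m; rewrite epos.
    have := ltn_pmod (pos z) m0; have := ltn_pmod (pos z') m0.
    by move: (pos z' %/ m * m)%N => q; clear; lia.
  move: close; rewrite /pos; case: (eqVneq `|du w|%N m) => [eum|num] close.
    suff le : (`|z.2%:Z - z'.2%:Z| <= `|z.1%:Z - z'.1%:Z|)%N.
      by rewrite (maxn_idPl le) leqNgt close.
    by rewrite -(leq_pmul2r m0) -{1}eum -ab leq_mul2l vm orbT.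
  have evm : (`|dv w| = m)%N.
    by move: num; rewrite /m /size /maxn; case: ifP; rewrite ?eqxx.
  suff le : (`|z.1%:Z - z'.1%:Z| <= `|z.2%:Z - z'.2%:Z|)%N.
    by rewrite (maxn_idPr le) leqNgt close.
  by rewrite -(leq_pmul2r m0) -{1}evm ab leq_mul2l um orbT.
by have := leq_card_in key (ratio_hits c lam) key_inj; rewrite card_prod !card_ord.
Qed.

(** * Power sums of the slope counts *)

(** The first term covers the counts 0 and 1. Otherwise [card_ratio_hits] gives a pair depending on
    [lam]; it is absorbed in a sum over all compatible pairs, ready to be exchanged with the sum
    over [lam]. *)
Lemma ratio_hits_pow_le (R : realFieldType) (p M n : nat) (c lam : 'F_p) :
  prime p -> (M < p)%N -> lam != 0 -> (0 < n)%N ->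
  #|@ratio_hits p M c lam|%:R ^+ n <= #|@ratio_hits p M c lam|%:R
    + (2 * (8 * M%:R ^+ 2 / p%:R)) ^+ n
    + \sum_(w : 'I_M * 'I_M | (w.2.+1%:R == lam * w.1.+1%:R)
                           || (w.2.+1%:R == - (lam * w.1.+1%:R)))
        (2 * (2 * M%:R / (maxn w.1.+1 w.2.+1)%:R)) ^+ n :> R.
Proof.
move=> p_pr ltMp lam0 n_gt0.
set N := #|_|; set S := \sum_(w | _) _.
have S0 : 0 <= S by apply: sumr_ge0 => w _; rewrite exprn_ge0 ?mulr_ge0 ?invr_ge0 ?ler0n.
have Q0 : 0 <= (2 * (8 * M%:R ^+ 2 / p%:R)) ^+ n :> R.
  by rewrite exprn_ge0 ?mulr_ge0 ?invr_ge0 ?exprn_ge0 ?ler0n.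
case: (ltnP 1 N) => [N1|]; last first.
  rewrite leq_eqVlt ltnS leqn0 => N01; rewrite -addrA ler_wpDr ?addr_ge0 //.
  by case/orP: N01 => /eqP->; rewrite ?expr1n // expr0n eqn0Ngt n_gt0.
have [u [v [huv]]] := card_ratio_hits _ _ _ _ p_pr ltMp lam0 N1.
rewrite -/N; set m := maxn _ _ => leN.
have p0 : 0 < p%:R :> R by rewrite ltr0n prime_gt0.
have m0 : 0 < m%:R :> R by rewrite ltr0n /m leq_max.
have mM : m%:R <= M%:R :> R by rewrite ler_nat geq_max !ltn_ord.
have leNR : N%:R <= 8 * M%:R ^+ 2 / p%:R + 2 * M%:R / m%:R :> R.
  have q1 : (4 * m * M %/ p).+1%:R <= 4 * m%:R * M%:R / p%:R + 1 :> R.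
    rewrite -natr1 lerD2r ler_pdivlMr // -!natrM ler_nat; exact: leq_divM.
  have q2 : (M %/ m).+1%:R <= M%:R / m%:R + 1 :> R.
    rewrite -natr1 lerD2r ler_pdivlMr // -!natrM ler_nat; exact: leq_divM.
  have : N%:R <= (4 * m%:R * M%:R / p%:R + 1) * (M%:R / m%:R + 1) :> R.
    apply: le_trans (ler_pM _ _ q1 q2); rewrite ?ler0n //.
    by rewrite -natrM ler_nat.
  move=> /le_trans; apply.
  (* As [m <= M], the second term is at most the first and the last at most the third, whence the
     constants 8 and 2. *)
  have -> : (4 * m%:R * M%:R / p%:R + 1) * (M%:R / m%:R + 1) =
    4 * M%:R ^+ 2 / p%:R + 4 * M%:R * m%:R / p%:R + M%:R / m%:R + 1 :> R.
    by field; rewrite !gt_eqF.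
  have h1 : 4 * M%:R * m%:R / p%:R <= 4 * M%:R ^+ 2 / p%:R :> R.
    by rewrite ler_pM2r ?invr_gt0 // -mulrA ler_pM2l // expr2 ler_wpM2l.
  have h2 : 1 <= M%:R / m%:R :> R by rewrite ler_pdivlMr // mul1r.
  by rewrite -!mulrA in h1 h2 *; lra.
have pow_max (a b : R) : 0 <= a -> 0 <= b -> (a + b) ^+ n <= (2 * a) ^+ n + (2 * b) ^+ n.
  move=> a0 b0; have ha : 0 <= (2 * a) ^+ n by rewrite exprn_ge0 ?mulr_ge0.
  have hb : 0 <= (2 * b) ^+ n by rewrite exprn_ge0 ?mulr_ge0.
  case: (lerP a b) => ab.
    by apply: ler_wpDl => //; rewrite lerXn2r ?nnegrE ?addr_ge0 ?mulr_ge0 //; lra.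
  by apply: ler_wpDr => //; rewrite lerXn2r ?nnegrE ?addr_ge0 ?mulr_ge0 //; lra.
apply: (le_trans (lerXn2r n _ _ leNR));
  rewrite ?nnegrE ?addr_ge0 ?mulr_ge0 ?invr_ge0 ?exprn_ge0 ?ler0n //.
apply: le_trans (pow_max _ _ _ _) _; rewrite ?mulr_ge0 ?invr_ge0 ?exprn_ge0 ?ler0n //.
rewrite -addrA ler_wpDl ?ler0n // lerD2l.
rewrite /S (bigD1 (u, v)) //=; apply: ler_wpDr; last by [].
by apply: sumr_ge0 => w _; rewrite exprn_ge0 ?mulr_ge0 ?invr_ge0 ?ler0n.
Qed.

(** As [c + z.1] is never zero, a pair [z] has at most one slope. *)
Lemma sum_card_ratio_hits (p M : nat) (c : 'F_p) :
  (forall x : 'I_M, c + x%:R != 0) ->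
  (\sum_(lam : 'F_p | lam != 0%R) #|@ratio_hits p M c lam| <= M ^ 2)%N.
Proof.
move=> c0.
under eq_bigr do rewrite -sum1_card big_mkcond /=.
rewrite exchange_big /=.
apply: (@leq_trans (\sum_(z : 'I_M * 'I_M) 1)); last first.
  by rewrite sum1_card card_prod card_ord mulnn.
apply: leq_sum => z _; rewrite -big_mkcondr sum1_card.
rewrite -(card1 ((c + z.2%:R) / (c + z.1%:R))).
apply: subset_leq_card; apply/fintype.subsetP => lam; rewrite !inE => /andP[_ /eqP ->].
by rewrite mulfK.
Qed.

Lemma sum_ratio_hits_pow_le (R : realFieldType) (p M n : nat) (c : 'F_p) :
  prime p -> (M < p)%N -> (0 < n)%N -> (forall x : 'I_M, c + x%:R != 0) ->
  \sum_(lam : 'F_p | lam != 0) #|@ratio_hits p M c lam|%:R ^+ n <= M%:R ^+ 2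
    + (2 * (8 * M%:R ^+ 2 / p%:R)) ^+ n *+ p
    + (\sum_(w : 'I_M * 'I_M) (2 * (2 * M%:R / (maxn w.1.+1 w.2.+1)%:R)) ^+ n) *+ 2 :> R.
Proof.
move=> p_pr ltMp n_gt0 c0.
apply: (le_trans (ler_sum _ (fun lam l0 => ratio_hits_pow_le R _ _ _ c lam p_pr ltMp l0 n_gt0))).
rewrite !big_split /=; apply: lerD; first apply: lerD.
- by rewrite -natr_sum -natrX ler_nat sum_card_ratio_hits.
- rewrite sumr_const ler_wpMn2l ?exprn_ge0 ?mulr_ge0 ?invr_ge0 ?exprn_ge0 ?ler0n //.
  by rewrite -[leqRHS](card_Fp p_pr) max_card.
(* Each [w] is compatible with at most two slopes, opposite to each other, whence the factor 2. *)
rewrite (exchange_big_dep xpredT) //= -sumrMnl; apply: ler_sum => w _.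
rewrite sumr_const ler_wpMn2l ?exprn_ge0 ?mulr_ge0 ?invr_ge0 ?ler0n //.
have w0 : w.1.+1%:R != 0 :> 'F_p.
  by rewrite -(dvdn_pcharf (pchar_Fp p_pr)) gtnNdvd // (leq_ltn_trans (ltn_ord _)).
pose l : 'F_p := w.2.+1%:R / w.1.+1%:R.
apply: (@leq_trans #|pred2 l (- l)|); last by rewrite card2; case: (_ != _).
apply: subset_leq_card; apply/fintype.subsetP => lam; rewrite !inE /l => /andP[_].
case/orP => /eqP ->; first by rewrite mulfK ?eqxx.
by rewrite mulNr opprK mulfK ?eqxx ?orbT.
Qed.

(** A partial sum of the zeta series at [g], harmonic when [g = 1]. The two halves of the theorem
    differ only in how it is estimated. *)
Definition invpow_sum (R : realFieldType) (g M : nat) : R :=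
  \sum_(u < M) (u.+1%:R ^+ g)^-1.

Lemma invpow_sum_ge1 (R : realFieldType) (g M : nat) :
  (0 < M)%N -> 1 <= invpow_sum R g M.
Proof.
case: M => // M _; rewrite /invpow_sum big_ord_recl /= expr1n invr1 ler_wpDr //.
by apply: sumr_ge0 => i _; rewrite invr_ge0 exprn_ge0 ?ler0n.
Qed.

Lemma sum_inv_max_le (R : realFieldType) (g M : nat) :
  \sum_(w : 'I_M * 'I_M) ((maxn w.1.+1 w.2.+1)%:R ^+ (2 * g))^-1
    <= invpow_sum R g M ^+ 2.
Proof.
rewrite expr2 /invpow_sum big_distrlr /= pair_big /=.
apply: ler_sum => -[u v] _ /=.
rewrite -invfM lef_pV2 ?posrE ?mulr_gt0 ?exprn_gt0 ?ltr0n ?leq_max //.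
(* [max (u, v) ^ (2g) >= u ^ g * v ^ g] decouples the two sums. *)
rewrite mul2n -addnn exprD ler_pM ?exprn_ge0 ?ler0n //.
  by rewrite lerXn2r ?nnegrE ?ler0n // ler_nat leq_maxl.
by rewrite lerXn2r ?nnegrE ?ler0n // ler_nat leq_maxr.
Qed.

(** The base 16 is [2 * 8] and dominates [4 = 2 * 2]; the factor 3 adds the term [M ^ 2] to the
    doubled sum over pairs. *)
Lemma sum_ratio_hits_evenpow_le (R : realFieldType) (p M g : nat) (c : 'F_p) :
  prime p -> (0 < M < p)%N -> (0 < g)%N -> (forall x : 'I_M, c + x%:R != 0) ->
  \sum_(lam : 'F_p | lam != 0) #|@ratio_hits p M c lam|%:R ^+ (2 * g) <=
    3 * 16 ^+ (2 * g) * (M%:R ^+ (2 * g) * invpow_sum R g M ^+ 2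
       + M%:R ^+ (4 * g) / p%:R ^+ (2 * g - 1)) :> R.
Proof.
move=> p_pr /andP[M0 ltMp] g0 c0.
have n0 : (0 < 2 * g)%N by rewrite muln_gt0.
apply: (le_trans (sum_ratio_hits_pow_le R _ _ _ c p_pr ltMp n0 c0)).
set h := invpow_sum R g M ^+ 2; set X := M%:R ^+ (2 * g).
set Y := M%:R ^+ (4 * g) / _.
have h1 : 1 <= h by rewrite exprn_ege1 ?invpow_sum_ge1.
have M1 : 1 <= M%:R :> R by rewrite ler1n.
have X0 : 0 <= X by rewrite exprn_ge0 ?ler0n.
have Y0 : 0 <= Y by rewrite mulr_ge0 ?invr_ge0 ?exprn_ge0 ?ler0n.
have p0 : 0 < p%:R :> R by rewrite ltr0n prime_gt0.
have e1 : M%:R ^+ 2 <= 1 * (X * h).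
  rewrite mul1r; apply: le_trans (ler_peMr X0 h1).
  by rewrite /X ler_weXn2l // leq_pmulr.
(* The [p] slopes cancel one of the [2 * g] factors [p] of the denominator. *)
have e2 : (2 * (8 * M%:R ^+ 2 / p%:R)) ^+ (2 * g) *+ p = 16 ^+ (2 * g) * Y :> R.
  have -> : 2 * (8 * M%:R ^+ 2 / p%:R) = 16 * (M%:R ^+ 2 / p%:R) :> R.
    by field; rewrite gt_eqF.
  rewrite exprMn -mulrnAr; congr (_ * _).
  rewrite exprMn -exprM mulnA exprVn /Y -mulr_natr -mulrA; congr (_ * _).
  rewrite -{1}(subnK n0) exprD expr1 invfM -mulrA mulVf ?mulr1 ?gt_eqF //.
have e3 : (\sum_(w : 'I_M * 'I_M) (2 * (2 * M%:R / (maxn w.1.+1 w.2.+1)%:R)) ^+ (2 * g)) *+ 2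
   <= 2 * 4 ^+ (2 * g) * (X * h) :> R.
  rewrite -mulr_natl -mulrA ler_pM2l // mulrA.
  under eq_bigr do rewrite mulrA mulrA -natrM [X in (X / _) ^+ _]mulrC exprMn exprVn.
  rewrite -big_distrr /= exprMn [4 ^+ _ * X]mulrC.
  by rewrite ler_wpM2l ?sum_inv_max_le // mulr_ge0 // exprn_ge0 ?ler0n.
have e4 : 4 ^+ (2 * g) <= 16 ^+ (2 * g) :> R by rewrite lerXn2r ?nnegrE ?ler0n ?ler_nat.
have e5 : 1 <= 16 ^+ (2 * g) :> R by rewrite exprn_ege1 ?ler1n.
have Xh0 : 0 <= X * h by rewrite mulr_ge0 // (le_trans _ h1).
rewrite e2; clear e2; move: e1 e3 e4 e5 Xh0 Y0.
move: (X * h) (16 ^+ _) (4 ^+ _) Y (\sum_w _) => a b d y s e1 e3 e4 e5 a0 y0.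
by nra.
Qed.

(** * From slopes to scalings *)

(** The polynomial [X ^ k - y] has at most [k] roots. *)
Lemma sum_pow_le (R : realFieldType) (F : finFieldType) (k : nat) (f : F -> R) :
  (0 < k)%N -> (forall x, 0 <= f x) ->
  \sum_(x | x != 0) f (x ^+ k) <= k%:R * \sum_(x | x != 0) f x.
Proof.
move=> k0 f0; rewrite (partition_big (fun x => x ^+ k) (fun y => y != 0)) /=; last first.
  by move=> x; apply: expf_neq0.
rewrite big_distrr /=; apply: ler_sum => y _.
rewrite (eq_bigr (fun=> f y)); last by move=> x /andP[_ /eqP ->].
rewrite sumr_const -[leLHS]mulr_natl ler_wpM2r // ler_nat.
have sz : seq.size ('X^k - y%:P) = k.+1 by rewrite size_XnsubC.
rewrite -ltnS -sz cardE; apply: max_poly_roots; rewrite ?enum_uniq //.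
  by rewrite -size_poly_eq0 sz.
apply/allP => x; rewrite mem_enum => /andP[_ /eqP <-].
by rewrite rootE !hornerE subrr.
Qed.

(** The product is at most the [#|I|]-th power of its largest factor. This separates the sides of
    the box. *)
Lemma prod_le_sum_exp (R : realFieldType) (I : finType) (a : I -> R) :
  (0 < #|I|)%N -> (forall i, 0 <= a i) ->
  \prod_i a i <= \sum_i a i ^+ #|I|.
Proof.
move=> /card_gt0P[i0 _] a0.
have [j _ maxj] := @arg_maxP _ _ _ i0 xpredT a isT.
apply: (@le_trans _ _ (a j ^+ #|I|)).
  rewrite -prodr_const; apply: ler_prod => i _; rewrite a0 /=; exact: maxj.
by rewrite (bigD1 j) //= ler_wpDr // sumr_ge0 // => i _; rewrite exprn_ge0.
Qed.

(** The factor [2 * g] counts the sides, and [4 * g + 2] bounds the number of [alpha] that give the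
    same slope on one side. *)
Lemma sum_prod_ratio_hits_le (R : realFieldType) (p M g : nat)
    (c : 'I_(2 * g) -> 'F_p) (k : 'I_(2 * g) -> nat) :
  prime p -> (0 < M < p)%N -> (0 < g)%N ->
  (forall i (x : 'I_M), c i + x%:R != 0) ->
  (forall i, 0 < k i <= 4 * g + 2)%N ->
  \sum_(alpha : 'F_p | alpha != 0)
      \prod_i #|@ratio_hits p M (c i) (alpha ^+ k i)|%:R <=
    (2 * g * (4 * g + 2))%:R * (3 * 16 ^+ (2 * g)) *
      (M%:R ^+ (2 * g) * invpow_sum R g M ^+ 2
       + M%:R ^+ (4 * g) / p%:R ^+ (2 * g - 1)) :> R.
Proof.
move=> p_pr hM g0 c0 hk; rewrite -mulrA; set B := _ * (_ + _) : R.
have le1 (alpha : 'F_p) : \prod_i #|@ratio_hits p M (c i) (alpha ^+ k i)|%:R <=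
    \sum_i #|@ratio_hits p M (c i) (alpha ^+ k i)|%:R ^+ (2 * g) :> R.
  have := @prod_le_sum_exp R 'I_(2 * g) (fun i => #|@ratio_hits p M (c i) (alpha ^+ k i)|%:R).
  by rewrite card_ord muln_gt0 g0; apply.
apply: (le_trans (ler_sum _ (fun alpha _ => le1 alpha))).
rewrite exchange_big /= natrM -mulrA -[X in X%:R * _]card_ord mulr_natl -sumr_const.
apply: ler_sum => i _; have /andP[ki0 kile] := hk i.
pose f (lam : 'F_p) : R := #|@ratio_hits p M (c i) lam|%:R ^+ (2 * g).
have f0 x : 0 <= f x by rewrite exprn_ge0 ?ler0n.
apply: (le_trans (sum_pow_le R _ _ f ki0 f0)).
apply: ler_pM; rewrite ?ler0n ?ler_nat ?sumr_ge0 //.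
exact: sum_ratio_hits_evenpow_le.
Qed.

(** * Isomorphic pairs of curves *)

(** Since [hisom] quantifies existentially over coefficient vectors, injectivity is what identifies
    them with the given ones. *)
Lemma hcurve_inj (F : fieldType) (g : nat) : injective (@hcurve F g).
Proof.
move=> a b /addrI /oppr_inj /polyC_inj /addrI eab; apply/rowP => j.
have coefj (d : 'rV[F]_(2 * g)) : (\sum_(i < 2 * g) d 0 i *: 'X^i)`_j = d 0 j.
  rewrite coef_sum (bigD1 j) //= coefZ coefXn eqxx mulr1 big1 ?addr0 // => i ij.
  by rewrite coefZ coefXn eq_sym val_eqE (negPf ij) mulr0.
by rewrite -coefj eab coefj.
Qed.

(** The quotient of the two scalings relative to [D] works for all coordinates at once. *)
Lemma hisom_common (F : fieldType) (g : nat) (a b : 'rV[F]_(2 * g)) D :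
  hisom g (hcurve a) D -> hisom g (hcurve b) D ->
  exists2 alpha : F, alpha != 0
    & forall i, b 0 i = alpha ^+ (4 * g + 2 - 2 * i) * a 0 i.
Proof.
move=> [a1 [d1 [s [/hcurve_inj <- -> s0 ha]]]] [b1 [d2 [t [/hcurve_inj <- /hcurve_inj <- t0 hb]]]].
exists (t / s) => [|i]; first by rewrite mulf_neq0 ?invr_neq0.
by rewrite ha hb expr_div_n mulrA divfK ?expf_neq0.
Qed.

(** A pair of functions regroups as a function into pairs, whose coordinates are constrained
    independently. *)
Lemma card_ffun_hits_le (I T : finType) (P : I -> pred (T * T)) :
  (#|[pred z : {ffun I -> T} * {ffun I -> T} | [forall i, P i (z.1 i, z.2 i)]]|
    <= \prod_i #|P i|)%N.
Proof.
pose f (z : {ffun I -> T} * {ffun I -> T}) : {ffun I -> T * T} := [ffun i => (z.1 i, z.2 i)].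
have f_inj : injective f.
  move=> [x y] [x' y'] /ffunP e; congr pair; apply/ffunP => i;
    by have := e i; rewrite !ffunE => -[].
have -> : (\prod_i #|P i| = #|family P|)%N.
  by rewrite card_family foldrE big_map big_enum.
rewrite -(fintype.card_image f_inj); apply: subset_leq_card.
apply/fintype.subsetP => y /fintype.imageP[z]; rewrite inE => /forallP hz ->.
by apply/familyP => i; rewrite ffunE; exact: hz.
Qed.

(** [card_collisions] is applied to a map [f] sending each point of the box to a representative;
    every collision of [f] comes from some scaling [alpha]. *)
Lemma card_representatives_ge (R : realFieldType) (p M g : nat)
    (r : 'I_(2 * g) -> int) (H : {fset {poly {poly 'F_p}}}) :
  (0 < g)%N -> prime p -> (0 < M < p)%N ->
  (forall j, 0 <= r j /\ r j + M%:Z < p%:Z) ->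
  is_representatives g (box_curves p r M) H ->
  (M%:R ^+ (2 * g)) ^+ 2 <= #|` H|%:R *
    ((2 * g * (4 * g + 2))%:R * (3 * 16 ^+ (2 * g)) *
      (M%:R ^+ (2 * g) * invpow_sum R g M ^+ 2
       + M%:R ^+ (4 * g) / p%:R ^+ (2 * g - 1))) :> R.
Proof.
move=> g0 p_pr hM hr [_ repH].
pose c i : 'F_p := (r i + 1)%:~R.
pose k (i : 'I_(2 * g)) := (4 * g + 2 - 2 * i)%N.
have hk i : (0 < k i <= 4 * g + 2)%N.
  by rewrite /k leq_subr subn_gt0 andbT; have := ltn_ord i; lia.
(* The integer [r i + 1 + x] lies between 1 and [r i + M < p]. *)
have c0 i (x : 'I_M) : c i + x%:R != 0.
  rewrite /c pmulrn -rmorphD /= -(dvdz_pcharf (pchar_Fp p_pr)) dvdzE /=.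
  have [r0 rM] := hr i; have xM := ltn_ord x; rewrite gtnNdvd //.
    by move: r0 xM; clear; lia.
  by move: r0 rM xM; clear; lia.
pose T := {ffun 'I_(2 * g) -> 'I_M}.
pose row (x : T) : 'rV['F_p]_(2 * g) := \row_i (c i + (x i)%:R).
have boxx (x : T) : box_curves p r M (hcurve (row x)).
  exists (\row_j (r j + 1 + (x j)%:Z)) => [j|].
    by rewrite mxE; have := ltn_ord (x j); move: (r j) => rj; lia.
  by congr hcurve; apply/rowP => j; rewrite !mxE rmorphD /= /c -pmulrn.
have hrep (x : T) : exists D : H, hisom g (hcurve (row x)) (val D).
  by have [D [[DH hD] _]] := repH _ (boxx x); exists [` DH]%fset.
have [f hf] := choice hrep.
have := card_collisions T H f.
rewrite card_ffun !card_ord -cardfE -(ler_nat R) natrX natrM natrX.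
move=> /le_trans; apply; rewrite ler_wpM2l ?ler0n //.
apply: le_trans (sum_prod_ratio_hits_le R p M g c k p_pr hM g0 c0 hk).
under eq_bigr do rewrite -natr_prod.
rewrite -natr_sum ler_nat.
pose P (alpha : 'F_p) (i : 'I_(2 * g)) : pred ('I_M * 'I_M) :=
  ratio_hits (c i) (alpha ^+ k i).
(* Union bound: each colliding pair is counted for at least one [alpha]. *)
apply: (@leq_trans (\sum_(alpha : 'F_p | alpha != 0)
   #|[pred z : T * T | [forall i, P alpha i (z.1 i, z.2 i)]]|)); last first.
  by apply: leq_sum => alpha _; exact: card_ffun_hits_le.
under [leqRHS]eq_bigr do rewrite -sum1_card big_mkcond.
rewrite exchange_big /= -sum1_card big_mkcond /=; apply: leq_sum => -[x y] _.
case: ifP => //; rewrite inE /= => /eqP fxy.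
have := hf y; rewrite -fxy => /(hisom_common _ _ _ _ _ (hf x))[alpha alpha0 hal].
rewrite (bigD1 alpha) //= [X in (0 < X + _)%N](_ : _ = 1%N) //.
case: ifP => //; rewrite inE /= => /negP; case; apply/forallP => i.
by have := hal i; rewrite !mxE /P /ratio_hits /= => ->.
Qed.

Lemma min_le_card_representatives (R : realFieldType) (p M g : nat)
    (r : 'I_(2 * g) -> int) (H : {fset {poly {poly 'F_p}}}) :
  (0 < g)%N -> prime p -> (0 < M < p)%N ->
  (forall j, 0 <= r j /\ r j + M%:Z < p%:Z) ->
  is_representatives g (box_curves p r M) H ->
  Num.min (p%:R ^+ (2 * g - 1)) (M%:R ^+ (2 * g) / invpow_sum R g M ^+ 2)
    <= 2 * ((2 * g * (4 * g + 2))%:R * (3 * 16 ^+ (2 * g))) * #|` H|%:R :> R.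
Proof.
move=> g0 p_pr hM hr repH.
have := card_representatives_ge R p M g r H g0 p_pr hM hr repH.
have /andP[M0 _] := hM.
set X := M%:R ^+ (2 * g); set P := p%:R ^+ _; set h := invpow_sum R g M ^+ 2.
set C := _ * (3 * _); set N := #|` H|%:R.
have -> : M%:R ^+ (4 * g) = X ^+ 2 by rewrite -exprM mulnAC.
have X0 : 0 < X by rewrite exprn_gt0 ?ltr0n.
have P0 : 0 < P by rewrite exprn_gt0 ?ltr0n ?prime_gt0.
have h0 : 0 < h by rewrite exprn_gt0 // (lt_le_trans ltr01) ?invpow_sum_ge1.
set m := Num.min _ _; set S := X * h + X ^+ 2 / P.
have S0 : 0 < S by apply: addr_gt0; [exact: mulr_gt0 | exact: divr_gt0 (exprn_gt0 _ X0) P0].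
(* Use [m <= X / h] on the first term of [S] and [m <= P] on the second; the factor [S] then
   cancels. *)
move=> le1; have : m * S <= 2 * X ^+ 2.
  have -> : 2 * X ^+ 2 = X / h * (X * h) + P * (X ^+ 2 / P).
    by field; rewrite !gt_eqF.
  rewrite /S mulrDr; apply: lerD.
    by rewrite ler_wpM2r /m ?ge_min ?lexx ?orbT // mulr_ge0 ?ltW.
  by rewrite ler_wpM2r /m ?ge_min ?lexx // (divr_ge0 (exprn_ge0 _ (ltW X0)) (ltW P0)).
move=> le2; rewrite -(ler_pM2r S0) (le_trans le2) //.
have -> : 2 * C * N * S = 2 * (N * (C * S)) by ring.
by rewrite ler_pM2l.
Qed.

(** * Growth of the inverse power sums *)

(** Induction on the sharper bound [2 - 1 / M], which telescopes since
    [1 / (x + 1) ^ 2 <= 1 / x - 1 / (x + 1)]. *)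
Lemma invpow_sum_le2 (R : realFieldType) (g M : nat) :
  (1 < g)%N -> invpow_sum R g M <= 2.
Proof.
move=> g1; case: M => [|M]; first by rewrite /invpow_sum big_ord0.
suff : invpow_sum R g M.+1 <= 2 - M.+1%:R^-1.
  by move=> /le_trans; apply; rewrite gerBl invr_ge0 ler0n.
elim: M => [|M IH].
  by rewrite /invpow_sum big_ord1 expr1n invr1; lra.
rewrite /invpow_sum big_ord_recr /= -/(invpow_sum R g M.+1).
have x0 : 0 < M.+1%:R :> R by rewrite ltr0n.
have -> : M.+2%:R = M.+1%:R + 1 :> R by rewrite natr1.
move: IH; move: (M.+1%:R) x0 => x x0 IH.
apply: le_trans (lerD IH (_ : _ <= ((x + 1) ^+ 2)^-1)) _.
  rewrite lef_pV2 ?posrE ?exprn_gt0 ?addr_gt0 // ler_weXn2l //; lra.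
rewrite -subr_ge0.
have -> : 2 - (x + 1)^-1 - (2 - x^-1 + ((x + 1) ^+ 2)^-1) = (x * (x + 1) ^+ 2)^-1.
  by field; rewrite !gt_eqF ?addr_gt0.
by rewrite invr_ge0 mulr_ge0 ?exprn_ge0 ?addr_ge0 ?ltW.
Qed.

(** Each new term [1 / n] is at most [ln n - ln (n - 1)], by [ln (1 + t) <= t] at [t = - 1 / n]. *)
Lemma invpow_sum_le_ln (R : realType) (g M : nat) :
  (0 < g)%N -> (0 < M)%N -> invpow_sum R g M <= 1 + ln M%:R.
Proof.
move=> g0; case: M => // M _; elim: M => [|M IH].
  by rewrite /invpow_sum big_ord1 expr1n invr1 ln1 addr0.
rewrite /invpow_sum big_ord_recr /= -/(invpow_sum R g M.+1).
have x0 : 0 < M.+1%:R :> R by rewrite ltr0n.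
have y0 : 0 < M.+2%:R :> R by rewrite ltr0n.
have step : (M.+2%:R)^-1 <= ln M.+2%:R - ln M.+1%:R :> R.
  have : ln (1 - (M.+2%:R)^-1) <= - (M.+2%:R)^-1 :> R.
    by apply: le_ln1Dx; rewrite ltrN2 invf_lt1 // ltr1n.
  have -> : 1 - (M.+2%:R)^-1 = M.+1%:R / M.+2%:R :> R.
    by rewrite -[M.+1%:R](addrK 1) natr1 mulrBl divff ?gt_eqF // mul1r.
  by rewrite ln_div ?posrE // lerNr opprB.
have pw : (M.+2%:R ^+ g)^-1 <= (M.+2%:R)^-1 :> R.
  by rewrite lef_pV2 ?posrE ?exprn_gt0 // -[leLHS]expr1 ler_weXn2l ?ler1n.
apply: le_trans (lerD IH (le_trans pw step)) _.
by rewrite -addrA [X in 1 + X <= _]addrC subrK.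
Qed.

(** This is the [o(1)] of the exponent; it vanishes in the limit because the sum grows at most
    logarithmically. *)
Lemma cvg_ln_invpow_sum (R : realType) (g : nat) : (0 < g)%N ->
  - (ln (invpow_sum R g n ^+ 2) / ln n%:R) @[n --> \oo] --> (0 : R).
Proof.
move=> g0; apply/cvgrPdist_le => e e0.
have e40 : 0 < e / 4 by rewrite divr_gt0.
near=> n.
have nK : expR (2 / (e / 4) ^+ 2 + 1) <= n%:R by near: n; exact: nbhs_infty_ger.
have n0 : 0 < n%:R :> R by apply: lt_le_trans nK; exact: expR_gt0.
have nn0 : (0 < n)%N by rewrite -(ltr0n R).
set L := ln n%:R.
have LK : 2 / (e / 4) ^+ 2 + 1 <= L.
  by rewrite -[leLHS]expRK /L ler_ln ?posrE ?expR_gt0.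
have q0 : 0 < 2 / (e / 4) ^+ 2 by rewrite divr_gt0 ?exprn_gt0.
have L0 : 0 < L by lra.
have h1 := invpow_sum_ge1 R g n nn0.
have h0 : 0 < invpow_sum R g n by lra.
(* The bound [1 + x ^ 2 / 2 <= expR x] at [x = e / 2 * L] dominates [1 + L] once
   [L * (e / 4) ^ 2 >= 2], whence the threshold on [n]. The half in [e / 2] pays for the square of
   the sum. *)
have hL : invpow_sum R g n <= expR (e / 2 * L).
  apply: le_trans (invpow_sum_le_ln R g n g0 nn0) _; rewrite -/L.
  apply: le_trans (expR_ge1Dxn 1 _); last by rewrite mulr_ge0 ?divr_ge0 ?ltW.
  rewrite lerD2l.
  have : 2 <= L * (e / 4) ^+ 2.
    by rewrite -ler_pdivrMr ?exprn_gt0 //; lra.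
  move=> h2; have := ler_wpM2l (ltW L0) h2.
  move=> h3; rewrite (_ : 2`! = 2)%N //.
  have -> : (e / 2 * L) ^+ 2 / 2%:R = 2 * (L * (L * (e / 4) ^+ 2)) by field.
  by move: h3; lra.
have lnh : 0 <= ln (invpow_sum R g n) <= e / 2 * L.
  by rewrite ln_ge0 //= -[leRHS]expRK ler_ln ?posrE ?expR_gt0.
rewrite sub0r opprK lnXn // ger0_norm; last first.
  by rewrite divr_ge0 ?(ltW L0) // mulrn_wge0 //; case/andP: lnh.
rewrite ler_pdivrMr //; move: lnh; lra.
Unshelve. all: by end_near.
Qed.

Lemma powR_eps_le (R : realType) (g M : nat) : (0 < M)%N ->
  M%:R `^ ((2 * g)%:R + - (ln (invpow_sum R g M ^+ 2) / ln M%:R))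
    = M%:R ^+ (2 * g) / invpow_sum R g M ^+ 2 :> R.
Proof.
move=> M0; have MR0 : 0 < M%:R :> R by rewrite ltr0n.
have h0 : 0 < invpow_sum R g M by rewrite (lt_le_trans ltr01) ?invpow_sum_ge1.
(* At [M = 1] the denominator [ln M] is zero, but both sides equal 1. *)
have [->|M1] := eqVneq M 1%N.
  by rewrite powR1 /invpow_sum big_ord1 !expr1n invr1 expr1n divr1.
rewrite powRD; last by rewrite (gt_eqF MR0) implybT.
rewrite powR_mulrn ?ltW //; congr (_ * _).
have L0 : 0 < ln M%:R :> R by rewrite ln_gt0 // ltr1n ltn_neqAle eq_sym M1.
by rewrite /powR gt_eqF // mulNr divfK ?gt_eqF // expRN lnK // posrE exprn_gt0.
Qed.

(** * The two lower bounds *)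

Theorem theorem8 (R : realType) (g : nat) (hg : (1 <= g)%N) :
  (exists (c : R) (eps : nat -> R),
    [/\ 0 < c,
        eps n @[n --> \oo] --> (0 : R)
      & forall (p M : nat) (r : 'I_(2 * g) -> int)
          (H : {fset {poly {poly 'F_p}}}),
          prime p -> coprime p (2 * (2 * g + 1)) ->
          (1 <= M)%N -> (M < p)%N ->
          (forall j, 0 <= r j /\ r j < r j + M%:Z /\ r j + M%:Z < p%:Z) ->
          is_representatives g (box_curves p r M) H ->
          c * Num.min (p%:R ^+ (2 * g - 1)) (M%:R `^ ((2 * g)%:R + eps M))
            <= #|` H|%:R]) /\
  ((2 <= g)%N ->
   exists c : R, 0 < c /\
     forall (p M : nat) (r : 'I_(2 * g) -> int)
       (H : {fset {poly {poly 'F_p}}}),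
       prime p -> coprime p (2 * (2 * g + 1)) ->
       (1 <= M)%N -> (M < p)%N ->
       (forall j, 0 <= r j /\ r j < r j + M%:Z /\ r j + M%:Z < p%:Z) ->
       is_representatives g (box_curves p r M) H ->
       p%:R `^ ((2 * g)%:R^-1) < (M%:R : R) ->
       c * Num.min (p%:R ^+ (2 * g - 1)) (M%:R ^+ (2 * g)) <= #|` H|%:R).
Proof.
pose C : R := 2 * ((2 * g * (4 * g + 2))%:R * (3 * 16 ^+ (2 * g))).
have C0 : 0 < C.
  by rewrite !mulr_gt0 ?exprn_gt0 // ltr0n !muln_gt0 hg addn_gt0 orbT.
have main p M (r : 'I_(2 * g) -> int) (H : {fset {poly {poly 'F_p}}}) :
    prime p -> (1 <= M)%N -> (M < p)%N ->
    (forall j, 0 <= r j /\ r j < r j + M%:Z /\ r j + M%:Z < p%:Z) ->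
    is_representatives g (box_curves p r M) H ->
    Num.min (p%:R ^+ (2 * g - 1)) (M%:R ^+ (2 * g) / invpow_sum R g M ^+ 2)
      <= C * #|` H|%:R.
  move=> p_pr M0 ltMp hr; apply: min_le_card_representatives => //.
    by rewrite M0.
  by move=> j; have [? []] := hr j.
split=> [|g2].
  (* This [eps] depends on [g] and [M] alone, which gives the uniformity in [p] and the box. *)
  exists C^-1, (fun n => - (ln (invpow_sum R g n ^+ 2) / ln n%:R)); split.
  - by rewrite invr_gt0.
  - exact: cvg_ln_invpow_sum.
  - move=> p M r H p_pr _ M0 ltMp hr repH.
    by rewrite powR_eps_le // ler_pdivrMl //; exact: (main _ _ _ _ p_pr M0 ltMp hr repH).
(* The factor 4 bounds the square of [invpow_sum], which is at most 2 for [g >= 2]. *)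
exists (4 * C)^-1; split; first by rewrite invr_gt0 mulr_gt0.
move=> p M r H p_pr _ M0 ltMp hr repH _.
rewrite (ler_pdivrMl _ _ (mulr_gt0 _ C0)) // -mulrA.
have h1 := invpow_sum_ge1 R g M M0; have h2 := invpow_sum_le2 R g M g2.
have h0 : 0 < invpow_sum R g M ^+ 2 by rewrite exprn_gt0 //; lra.
have h4 : invpow_sum R g M ^+ 2 <= 4 by nra.
apply: le_trans (ler_wpM2l _ (main _ _ _ _ p_pr M0 ltMp hr repH)); last by [].
rewrite minr_pMr // le_min !ge_min; apply/andP; split; apply/orP; [left|right].
  by rewrite ler_peMl ?exprn_ge0 ?ler0n // ler1n.
by rewrite mulrA ler_pdivlMr // mulrC ler_wpM2r ?exprn_ge0 ?ler0n.
Qed.
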